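(* Let $L\subset\mathbb{R}^n$ be a lattice of full rank. The following three statements are equivalent: (1) $d(L)=n$; (2) $\nu(L)>0$; (3) $s_1(L)=\dots=s_n(L)=1$. Further, a full-rank lattice $L'\subset\mathbb{R}^n$ is virtually rectangular if and only if it is isometric to some full-rank lattice $L\subset\mathbb{R}^n$ satisfying these three equivalent conditions.
   Context: Write $L=A\mathbb{Z}^n$ with basis matrix $A\in\operatorname{GL}_n(\mathbb{R})$ (columns form a basis) and rows $\boldsymbol a_1,\dots,\boldsymbol a_n$. For a nonzero $\boldsymbol x\in\mathbb{R}^n$, $d(\boldsymbol x)=\dim_{\mathbb{Q}}\operatorname{span}_{\mathbb{Q}}\{x_1,\dots,x_n\}$. $d(L)=\sum_{i=1}^n d(\boldsymbol a_i)$ (independent of the basis matrix). If $d(\boldsymbol x)=1$, write $\boldsymbol x=\alpha\boldsymbol f$ with $\alpha\in\mathbb{R}$ and $\boldsymbol f\in\mathbb{Z}^n$ having relatively prime coordinates and set $\nu(\boldsymbol x)=|\alpha|$; if $d(\boldsymbol x)>1$ set $\nu(\boldsymbol x)=0$. Then $\nu(L)=\prod_{i=1}^n\nu(\boldsymbol a_i)$ (independent of the basis matrix). $\|\boldsymbol x\|_0$ is the number of nonzero coordinates of $\boldsymbol x$, and $s_i(L)$ is the minimal $s$ such that $L$ contains $i$ linearly independent vectors each with $\|\cdot\|_0\le s$. A lattice is rectangular if it has an orthogonal basis, and virtually rectangular if it contains a rectangular sublattice of finite index. Lattices $L,L'$ are isometric if $L'=UL$ for some real orthogonal matrix $U$.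 *)

(* Defs.v *)
From HB Require Import structures.
From mathcomp Require Import all_boot all_order all_algebra.
From mathcomp Require Import all_classical all_reals.

Set Implicit Arguments.
Unset Strict Implicit.
Unset Printing Implicit Defensive.

Import Order.TTheory GRing.Theory Num.Theory.

Local Open Scope classical_set_scope.
Local Open Scope ring_scope.

Section Defs.
Variable R : realType.

(* R as a vector space over rat; finite families of reals are row vectors. *)
Definition Qcomb k (q : 'rV[rat]_k) (b : 'rV[R]_k) : R :=
  \sum_(j < k) ratr (q 0 j) * b 0 j.

Definition Qspan k (b : 'rV[R]_k) : set R :=
  [set Qcomb q b | q in [set: 'rV[rat]_k]].

Definition Qfree k (b : 'rV[R]_k) : Prop :=
  forall q : 'rV[rat]_k, Qcomb q b = 0 -> q = 0.

(* The size of a Q-basis of V; 0 if V has no finite Q-basis. *)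
Definition Qdim (V : set R) : nat :=
  xget 0%N [set k | exists b : 'rV[R]_k, Qfree b /\ Qspan b = V].

Definition vec_d n (x : 'rV[R]_n) : nat := Qdim (Qspan x).

(* Jointly (not pairwise) relatively prime coordinates. *)
Definition primitive n (f : 'rV[int]_n) : Prop :=
  \big[gcdn/0%N]_(j < n) absz (f 0 j) = 1%N.

(* The vector f is unique up to sign when x <> 0, so |alpha| is determined
   by x. *)
Definition vec_nu n (x : 'rV[R]_n) : R :=
  if vec_d x == 1%N then
    xget 0 [set r | exists (alpha : R) (f : 'rV[int]_n),
      [/\ primitive f, x = alpha *: map_mx intr f & r = `|alpha|]]
  else 0.

Definition lattice_of n k (B : 'M[R]_(n, k)) : set 'cV[R]_n :=
  [set B *m map_mx intr z | z in [set: 'cV[int]_k]].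

Definition basis_matrix n (L : set 'cV[R]_n) (A : 'M[R]_n) : Prop :=
  A \in unitmx /\ L = lattice_of A.

Definition full_rank_lattice n (L : set 'cV[R]_n) : Prop :=
  exists A : 'M[R]_n, basis_matrix L A.

(* d(L) and nu(L) do not depend on the basis matrix: an arbitrary one is
   selected. *)
Definition some_basis_matrix n (L : set 'cV[R]_n) : 'M[R]_n :=
  xget 0 [set A | basis_matrix L A].

Definition lat_d n (L : set 'cV[R]_n) : nat :=
  (\sum_(i < n) vec_d (row i (some_basis_matrix L)))%N.

Definition lat_nu n (L : set 'cV[R]_n) : R :=
  \prod_(i < n) vec_nu (row i (some_basis_matrix L)).

Definition norm0 n (x : 'cV[R]_n) : nat := #|[set j | x j 0 != 0]%SET|.

Definition has_sparse_free n (L : set 'cV[R]_n) (i s : nat) : Prop :=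
  exists X : i.-tuple 'cV[R]_n,
    free X /\ forall x, x \in X -> L x /\ (norm0 x <= s)%N.

Definition succ_sparsity n (L : set 'cV[R]_n) (i : nat) : nat :=
  xget 0%N [set s | has_sparse_free L i s /\
                    forall t, has_sparse_free L i t -> (s <= t)%N].

(* Here the lattice may have any rank k <= n; the Gram matrix B^T B is diagonal
   exactly when the columns of B are pairwise orthogonal. *)
Definition rectangular n (M : set 'cV[R]_n) : Prop :=
  exists (k : nat) (B : 'M[R]_(n, k)),
    [/\ \rank B = k, is_diag_mx (B^T *m B) & M = lattice_of B].

Definition finite_index n (M L : set 'cV[R]_n) : Prop :=
  finite_set [set [set x + m | m in M] | x in L].

Definition virtually_rectangular n (L : set 'cV[R]_n) : Prop :=
  exists M : set 'cV[R]_n, [/\ M `<=` L, rectangular M & finite_index M L].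

Definition isometric n (L L' : set 'cV[R]_n) : Prop :=
  exists U : 'M[R]_n, U^T *m U = 1%:M /\ L' = [set U *m x | x in L].

End Defs.

(* Main.v *)
(* Call a lattice axial if it meets every coordinate axis outside the origin.
   If A is a basis matrix and A Z = D with Z integral and D diagonal and
   invertible, then det(Z) A = D adj(Z), so each row of A is a multiple of an
   integral vector; conversely, if A = D F with F integral then A adj(F) =
   det(F) D. Hence each of d(L) = n, nu(L) > 0 and s_1 = ... = s_n = 1 says that
   L is axial. An axial lattice contains the rectangular lattice D Z^n, of
   finite index since det(Z) Z^n is contained in Z Z^n. Conversely, a sublattice
   B Z^k of finite index has full rank; if its basis is orthogonal then B = V D
   with V orthogonal, and V^T L' contains the columns of D. *)
Require Import Defs.
From HB Require Import structures.
From mathcomp Require Import all_boot all_order all_algebra.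
From mathcomp Require Import all_classical all_reals.

Import Order.TTheory GRing.Theory Num.Theory.

Local Open Scope classical_set_scope.
Local Open Scope ring_scope.

Set Implicit Arguments.
Unset Strict Implicit.
Unset Printing Implicit Defensive.

(** * Rational spans of finite families of reals, and the dimension d of a vector *)

Lemma QcombP (R : realType) k (b : 'rV[R]_k) a (p q : 'rV[rat]_k) :
  Qcomb (a *: p + q) b = ratr a * Qcomb p b + Qcomb q b.
Proof.
rewrite /Qcomb mulr_sumr -big_split; apply: eq_bigr => j _.
by rewrite !mxE rmorphD rmorphM mulrDl mulrA.
Qed.

Lemma Qcomb_delta (R : realType) k (b : 'rV[R]_k) j :
  Qcomb (delta_mx 0 j) b = b 0 j.
Proof.
rewrite /Qcomb (bigD1 j) //= big1 => [|i ne_ij]; rewrite !mxE ?eqxx /=.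
  by rewrite rmorph1 mul1r addr0.
by rewrite (negPf ne_ij) rmorph0 mul0r.
Qed.

Lemma Qspan_coord (R : realType) k (b : 'rV[R]_k) j : Qspan b (b 0 j).
Proof. by exists (delta_mx 0 j) => //; rewrite Qcomb_delta. Qed.

Lemma Qspan_has_basis (R : realType) n (x : 'rV[R]_n) :
  exists k (b : 'rV[R]_k), Qfree b /\ Qspan b = Qspan x.
Proof.
elim: n x => [|n IHn] x; first by exists 0%N, x; split=> // q _; apply: thinmx0.
have [xfree | /existsNP[q /not_implyP[qx0 /eqP/rV0Pn[j qj0]]]] := pselect (Qfree x).
  by exists n.+1, x.
have [k [b [bfree spanb]]] := IHn (col' j x).
exists k, b; split=> //; rewrite {}spanb.
apply/seteqP; split=> _ [p _ <-].
  exists (\row_i oapp (p 0) 0 (unlift j i)) => //.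
  rewrite /Qcomb (bigD1_ord j) //= mxE unlift_none rmorph0 mul0r add0r.
  by apply: eq_bigr => i _; rewrite !mxE liftK.
(* The multiple of the relation [q] that clears position [j] of [p] leaves the value of the
   combination unchanged. *)
set r := (- (p 0 j / q 0 j)) *: q + p.
have rj0 : r 0 j = 0 by rewrite !mxE mulNr divfK ?addNr.
have -> : Qcomb p x = Qcomb r x by rewrite QcombP qx0 mulr0 add0r.
exists (col' j r) => //.
rewrite /Qcomb [RHS](bigD1_ord j) //= rj0 rmorph0 mul0r add0r.
by apply: eq_bigr => i _; rewrite !mxE.
Qed.

Lemma vec_dP (R : realType) n (x : 'rV[R]_n) :
  exists b : 'rV[R]_(vec_d x), Qfree b /\ Qspan b = Qspan x.
Proof. exact: xgetPex (Qspan_has_basis x). Qed.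

Lemma vec_d_gt0 (R : realType) n (x : 'rV[R]_n) : x != 0 -> (0 < vec_d x)%N.
Proof.
move=> /rV0Pn[j xj0]; rewrite lt0n; apply/eqP => d0.
have [b [_ spanb]] := vec_dP x; move: b spanb; rewrite d0 => b spanb.
have := Qspan_coord x j; rewrite -spanb => -[q _].
by rewrite /Qcomb big_ord0 => /esym/eqP; rewrite (negPf xj0).
Qed.

(** * Vectors with d = 1 as real multiples of integral vectors, and the invariant nu *)

Definition integral_line (R : realType) n (x : 'rV[R]_n) :=
  exists alpha (f : 'rV[int]_n), x = alpha *: map_mx intr f.

Lemma common_denominator n (q : 'rV[rat]_n) :
  exists (d : int) (f : 'rV[int]_n),
    d != 0 /\ q = (d%:~R)^-1 *: map_mx intr f.
Proof.
pose d := \prod_j denq (q 0 j).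
have d0 : d != 0 by apply/prodf_neq0 => j _; apply: denq_neq0.
exists d, (\row_j (numq (q 0 j) * \prod_(i | i != j) denq (q 0 i))).
split=> //; apply/rowP => j; rewrite !mxE.
have d0' : (d%:~R : rat) != 0 by rewrite intr_eq0.
apply: (mulfI d0').
rewrite mulVKf // /d (bigD1 j) //= !rmorphM /= -{2}[q 0 j]divq_num_den.
by rewrite mulrC mulrA divfK // intr_eq0 denq_neq0.
Qed.

(** If one real spans, the coordinates are rational multiples of it, and a common denominator makes
    the factors integral. Conversely, the whole span consists of rational multiples of [alpha], and
    any two of these are linearly dependent over the rationals. *)
Lemma vec_d_eq1 (R : realType) n (x : 'rV[R]_n) :
  x != 0 -> vec_d x = 1%N <-> integral_line x.
Proof.
move=> x0; split=> [d1|[alpha [f def_x]]].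
  have [b [_ spanb]] := vec_dP x; move: b spanb; rewrite d1 => b spanb.
  have coord j : {q : rat | x 0 j = ratr q * b 0 0}.
    apply/cid; have := Qspan_coord x j; rewrite -spanb => -[q _ <-].
    by exists (q 0 0); rewrite /Qcomb big_ord1.
  have [d [f [d0 def_q]]] := common_denominator (\row_j sval (coord j)).
  exists (b 0 0 / d%:~R), f; apply/rowP => j; rewrite !mxE (svalP (coord j)).
  have /rowP/(_ j) := def_q; rewrite !mxE => ->.
  by rewrite rmorphM fmorphV /= !ratr_int mulrC mulrA.
apply/eqP; rewrite eqn_leq vec_d_gt0 // andbT.
have [b [bfree spanb]] := vec_dP x; move: (vec_d x) b bfree spanb.
case=> [//|[//|k]] b bfree spanb; exfalso.
have coord j : {r : rat | b 0 j = ratr r * alpha}.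
  apply: cid; have := Qspan_coord b j; rewrite spanb => -[q _ <-].
  exists (\sum_i q 0 i * (f 0 i)%:~R).
  rewrite /Qcomb rmorph_sum mulr_suml; apply: eq_bigr => i _.
  by rewrite def_x !mxE rmorphM /= ratr_int [RHS]mulrAC; apply: mulrA.
pose r j := sval (coord j).
have r0 : r ord0 = 0.
  (* The evident relation between two multiples of [alpha]. Freeness kills its coefficient [r ord0],
     which makes the first basis element 0, again against freeness. *)
  pose q : 'rV[rat]_k.+2 := r ord0 *: delta_mx 0 ord_max + (- r ord_max) *: delta_mx 0 ord0.
  have /bfree/rowP/(_ ord_max) : Qcomb q b = 0.
    rewrite /q -[_ *: delta_mx 0 ord0]addr0 !QcombP !Qcomb_delta.
    have -> : Qcomb 0 b = 0.
      by rewrite /Qcomb big1 // => i _; rewrite mxE rmorph0 mul0r.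
    rewrite (svalP (coord ord0)) (svalP (coord ord_max)) -/(r _) -/(r _) rmorphN.
    by rewrite addr0 mulNr mulrCA addrN.
  by rewrite !mxE !eqxx /= mulr1 mulr0 addr0.
have /bfree/rowP/(_ ord0) : Qcomb (delta_mx 0 ord0) b = 0.
  by rewrite Qcomb_delta (svalP (coord ord0)) -/(r _) r0 rmorph0 mul0r.
by rewrite !mxE => /eqP; rewrite oner_eq0.
Qed.

(** Divide by the gcd [g] of the coordinates: [g] times the gcd of the quotients is again [g], and
    [g] can be cancelled. *)
Lemma primitive_part n (f : 'rV[int]_n) :
  f != 0 -> exists (g : int) (h : 'rV[int]_n), primitive h /\ f = g *: h.
Proof.
move=> /rV0Pn[j fj0]; pose g := \big[gcdn/0%N]_(i < n) absz (f 0 i).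
have g_dvd i : dvdn g (absz (f 0 i)) by apply: biggcdn_inf.
have g0 : (0 < g)%N by rewrite (dvdn_gt0 _ (g_dvd j)) // absz_gt0.
have fE i : f 0 i = divz (f 0 i) g * g by rewrite divzK // dvdzE g_dvd.
exists g, (\row_i divz (f 0 i) g); split; last first.
  by apply/rowP => i; rewrite !mxE mulrC -fE.
apply/eqP; rewrite -(eqn_pmul2r g0) mul1n; apply/eqP.
rewrite (big_morph (muln^~ g) (id1 := 0%N) (op1 := gcdn)) //; last first.
  by move=> a b; rewrite muln_gcdl.
by apply: eq_bigr => i _; rewrite mxE [in RHS]fE abszM.
Qed.

Lemma vec_nu_ge0 (R : realType) n (x : 'rV[R]_n) : 0 <= vec_nu x.
Proof.
rewrite /vec_nu; case: ifP => // _.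
by case: xgetP => // r _ [alpha [f [_ _ ->]]].
Qed.

Lemma vec_nu_neq0 (R : realType) n (x : 'rV[R]_n) :
  x != 0 -> vec_nu x != 0 <-> vec_d x = 1%N.
Proof.
move=> x0; rewrite /vec_nu; case: (vec_d x =P 1%N) => d1; last by rewrite eqxx.
split=> // _; case: xgetP => [r _ [alpha [f [_ def_x ->]]]|none].
  by rewrite normr_eq0; apply: contraNneq x0 => alpha0; rewrite def_x alpha0 scale0r.
(* Here [xget] would fall back on its default 0; the primitive part of an integral direction shows
   that the set is inhabited. *)
have [alpha [f def_x]] := (vec_d_eq1 x0).1 d1.
have f0 : f != 0 by apply: contraNneq x0 => f0; rewrite def_x f0 map_mx0 scaler0.
have [g [h [hprim def_f]]] := primitive_part f0.
case: (none `|alpha * g%:~R|); exists (alpha * g%:~R), h; split=> //.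
by rewrite def_x def_f map_mxZ scalerA.
Qed.

(** * Axial lattices, read off from the rows of a basis matrix *)

Lemma unitmx_row_neq0 (F : fieldType) n (A : 'M[F]_n) i :
  A \in unitmx -> row i A != 0.
Proof.
move=> Au; apply/eqP => ri0.
have /matrixP/(_ i i) := mulmxV Au.
rewrite mxE big1 => [|j _]; last first.
  by have /rowP/(_ j) := ri0; rewrite !mxE => ->; rewrite mul0r.
by rewrite mxE eqxx => /eqP; rewrite eq_sym oner_eq0.
Qed.

Definition axial (R : realType) n (L : set 'cV[R]_n) :=
  forall i, exists2 c : R, c != 0 & L (c *: delta_mx i 0).

Lemma unitmx_diag (F : fieldType) n (d : 'rV[F]_n) :
  (forall i, d 0 i != 0) -> diag_mx d \in unitmx.
Proof. by move=> d0; rewrite unitmxE unitfE det_diag; apply/prodf_neq0. Qed.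

(** The columns of [Z] are the integral coordinates, with respect to [A], of one lattice vector
    chosen on each axis. *)
Lemma axial_diag (R : realType) n (A : 'M[R]_n) :
  axial (lattice_of A) ->
  exists (c : 'rV[R]_n) (Z : 'M[int]_n),
    (forall i, c 0 i != 0) /\ A *m map_mx intr Z = diag_mx c.
Proof.
move=> axA.
have /choice[f fP] i : exists cz : R * 'cV[int]_n,
    cz.1 != 0 /\ A *m map_mx intr cz.2 = cz.1 *: delta_mx i 0.
  by have [c c0 [z _ Az]] := axA i; exists (c, z).
exists (\row_i (f i).1), (\matrix_(i, j) (f j).2 i 0); split=> [i|].
  by rewrite mxE; have [] := fP i.
apply/matrixP => i j; have [_ /matrixP/(_ i 0)] := fP j.
rewrite !mxE eqxx andbT mulr_natr => Azj.
transitivity ((f j).1 *+ (i == j)); last by case: eqVneq => // ->.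
by rewrite -Azj; apply: eq_bigr => k _; rewrite !mxE.
Qed.

Lemma axial_rows (R : realType) n (A : 'M[R]_n) :
  A \in unitmx ->
  axial (lattice_of A) <-> forall i, integral_line (row i A).
Proof.
move=> Au; split=> [/axial_diag[c [Z [c0 AZ]]] i|rowsA].
  have : \det (A *m map_mx intr Z) != 0.
    by rewrite AZ -unitfE -unitmxE unitmx_diag.
  rewrite det_mulmx mulf_eq0 negb_or det_map_mx => /andP[_ Z0].
  have detA : (\det Z)%:~R *: A = diag_mx c *m map_mx intr (\adj Z).
    by rewrite -AZ -mulmxA -map_mxM mul_mx_adj map_scalar_mx mul_mx_scalar.
  exists (c 0 i / (\det Z)%:~R), (row i (\adj Z)); apply/rowP => j.
  have /matrixP/(_ i j) := detA; rewrite mul_diag_mx !mxE => detAij.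
  by rewrite mulrAC -detAij mulrC mulKf.
have /choice[f fP] i : exists af : R * 'rV[int]_n,
    row i A = af.1 *: map_mx intr af.2.
  by have [a [f fP]] := rowsA i; exists (a, f).
pose a := \row_i (f i).1; pose F := \matrix_(i, j) (f i).2 0 j.
have def_A : A = diag_mx a *m map_mx intr F.
  apply/matrixP => i j; have /rowP/(_ j) := fP i.
  by rewrite mul_diag_mx !mxE.
have : \det A != 0 by rewrite -unitfE -unitmxE.
rewrite {1}def_A det_mulmx mulf_eq0 negb_or det_diag det_map_mx.
move=> /andP[/prodf_neq0 a0 F0] i.
exists ((\det F)%:~R * a 0 i); first by rewrite mulf_neq0 ?a0.
exists (col i (\adj F)) => //.
rewrite colE map_mxM map_delta_mx def_A mulmxA -[_ *m map_mx _ (\adj F)]mulmxA.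
rewrite -map_mxM mul_mx_adj map_scalar_mx mul_mx_scalar -colE; apply/colP => j; rewrite !mxE eqxx andbT.
by case: eqVneq => [->|_]; rewrite ?mulr1 ?mulr0.
Qed.

Lemma basis_matrix_some (R : realType) n (L : set 'cV[R]_n) :
  full_rank_lattice L -> basis_matrix L (some_basis_matrix L).
Proof. exact: xgetPex. Qed.

(** Axiality mentions no basis, so the criterion holds whichever basis matrix is selected. *)
Lemma axial_vec_d (R : realType) n (L : set 'cV[R]_n) :
  full_rank_lattice L ->
  axial L <-> forall i, vec_d (row i (some_basis_matrix L)) = 1%N.
Proof.
move=> /basis_matrix_some[Au {1}->]; rewrite (axial_rows Au).
by split=> rowsA i; apply/vec_d_eq1=> //; apply: unitmx_row_neq0.
Qed.

(** The rows of an invertible matrix are nonzero, so each of the [n] summands is at least 1; their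
    sum is [n] exactly when all equal 1. *)
Lemma lat_d_axial (R : realType) n (L : set 'cV[R]_n) :
  full_rank_lattice L -> lat_d L = n <-> axial L.
Proof.
move=> latL; rewrite axial_vec_d //; have [Au _] := basis_matrix_some latL.
rewrite /lat_d; set A := some_basis_matrix L.
have [_ sum_eq] : (\sum_(i < n) 1 <= \sum_(i < n) vec_d (row i A)
    ?= iff [forall i, 1%N == vec_d (row i A)])%N.
  by apply: leqif_sum => i _; split=> //; apply/vec_d_gt0/unitmx_row_neq0.
rewrite sum1_card card_ord in sum_eq.
split=> [/esym/eqP|d1]; last by apply/esym/eqP; rewrite sum_eq; apply/forallP => i; rewrite d1.
by rewrite sum_eq => /forallP d1 i; apply/esym/eqP/d1.
Qed.

Lemma lat_nu_axial (R : realType) n (L : set 'cV[R]_n) :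
  full_rank_lattice L -> 0 < lat_nu L <-> axial L.
Proof.
move=> latL; rewrite axial_vec_d //; have [Au _] := basis_matrix_some latL.
have nu0 i := vec_nu_neq0 (unitmx_row_neq0 i Au).
rewrite lt0r prodr_ge0 ?andbT => [|i _]; last exact: vec_nu_ge0.
by split=> [/prodf_neq0 d1 i|d1]; [|apply/prodf_neq0 => i _]; apply/nu0=> //; apply: d1.
Qed.

(** * Sparse vectors and the successive sparsities *)

Lemma norm0_gt0 (R : realType) n (x : 'cV[R]_n) : x != 0 -> (0 < norm0 x)%N.
Proof. by move=> /cV0Pn[j xj0]; apply/card_gt0P; exists j; rewrite inE. Qed.

Lemma norm0_scale_delta (R : realType) n (c : R) (i : 'I_n) :
  (norm0 (c *: delta_mx i 0)%R <= 1)%N.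
Proof.
rewrite -[leqRHS](cards1 i); apply/subset_leq_card/fintype.subsetP => j.
by rewrite !inE !mxE eqxx andbT; case: (eqVneq j i) => // _; rewrite mulr0 eqxx.
Qed.

Lemma norm0_le1 (R : realType) n (x : 'cV[R]_n) i :
  (norm0 x <= 1)%N -> x i 0 != 0 -> x = x i 0 *: delta_mx i 0.
Proof.
move=> /card_le1_eqP x1 xi0; apply/colP => j; rewrite !mxE eqxx andbT.
have [->|ne_ji] := eqVneq j i; first by rewrite mulr1.
rewrite mulr0; apply/eqP; apply: contraNT ne_ji => xj0.
by apply/eqP/x1; rewrite inE.
Qed.

Lemma has_sparse_free_gt0 (R : realType) n (L : set 'cV[R]_n) i s :
  (0 < i)%N -> has_sparse_free L i s -> (0 < s)%N.
Proof.
case: i => // i _ [X [Xfree XL]].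
have XinX : tnth X ord0 \in X by apply: mem_tnth.
have [_] := XL _ XinX; apply: leq_trans.
exact/norm0_gt0/(free_not0 Xfree).
Qed.

(** A nonempty free family contains a nonzero vector, so 1 is minimal once attained. The value 1
    cannot be the default, which is 0. *)
Lemma succ_sparsity_eq1 (R : realType) n (L : set 'cV[R]_n) i :
  (0 < i)%N -> succ_sparsity L i = 1%N <-> has_sparse_free L i 1.
Proof.
move=> i0; split=> [|L1].
  by rewrite /succ_sparsity; case: xgetP => // s -> [Ls _] s1; rewrite -s1.
have s1 t : has_sparse_free L i t -> (1 <= t)%N by apply: has_sparse_free_gt0.
apply: xget_unique => // t [Lt tmin]; apply/eqP.
by rewrite eqn_leq tmin //= s1.
Qed.

(** By dimension [X] is a basis; if all its members vanished at [i], so would [delta_mx i 0]. *)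
Lemma free_coord_neq0 (K : fieldType) n (X : n.-tuple 'cV[K]_n) i :
  free X -> exists2 x, x \in X & x i 0 != 0.
Proof.
move=> Xfree; apply/hasP; apply: contraTT (oner_neq0 K) => /hasPn X0.
have Xbasis : basis_of fullv X.
  by rewrite basisEfree Xfree subvf dimvf dim_matrix size_tuple [leqLHS]muln1 leqnn.
have := coord_basis Xbasis (memvf (delta_mx i 0)).
move=> /colP/(_ i); rewrite mxE !eqxx mulr1n summxE big1 => [->|j _]; first by rewrite eqxx.
by have := X0 X`_j; rewrite mem_nth ?size_tuple // mxE => /(_ isT)/negPn/eqP->; rewrite mulr0.
Qed.

Lemma succ_sparsity_axial (R : realType) n (L : set 'cV[R]_n) :
  (forall i, (1 <= i <= n)%N -> succ_sparsity L i = 1%N) <-> axial L.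
Proof.
split=> [L1 i|axL i /andP[i0 le_in]].
  have n0 : (0 < n)%N by apply: leq_ltn_trans (ltn_ord i).
  (* The last sparsity yields [n] independent vectors, one of which is nonzero at [i]; having a
     single nonzero coordinate, it lies on axis [i]. *)
  have /succ_sparsity_eq1 : succ_sparsity L n = 1%N by rewrite L1 ?n0 /=.
  move=> /(_ n0)[X [Xfree XL]]; have [x xX xi0] := free_coord_neq0 i Xfree.
  by have [Lx x1] := XL x xX; exists (x i 0) => //; rewrite -norm0_le1.
apply/succ_sparsity_eq1 => //.
have /choice[c cP] j : exists c : R, c != 0 /\ L (c *: delta_mx j 0).
  by have [c] := axL j; exists c.
pose w := widen_ord le_in.
exists [tuple c (w j) *: delta_mx (w j) 0 | j < i]; split; last first.
  move=> _ /tnthP[j ->]; rewrite tnth_mktuple; split; first by have [] := cP (w j).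
  exact: norm0_scale_delta.
apply/freeP => k /colP sum0 j; have := sum0 (w j).
rewrite summxE (bigD1 j) // big1 => [|l ne_lj]; last first.
  rewrite -tnth_nth tnth_mktuple !mxE eqxx andbT.
  have -> : (w j == w l) = (j == l) by [].
  by rewrite eq_sym (negPf ne_lj) !mulr0.
rewrite -tnth_nth tnth_mktuple !mxE !eqxx mulr1 /= addr0 => /eqP.
by rewrite mulf_eq0 (negPf (cP _).1) orbF => /eqP.
Qed.

(** * Lattice arithmetic and sublattices of finite index *)

Lemma lattice_of0 (R : realType) n k (B : 'M[R]_(n, k)) : lattice_of B 0.
Proof. by exists 0 => //; rewrite map_mx0 mulmx0. Qed.

Lemma lattice_ofD (R : realType) n k (B : 'M[R]_(n, k)) x y :
  lattice_of B x -> lattice_of B y -> lattice_of B (x + y).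
Proof. by move=> [z _ <-] [t _ <-]; exists (z + t) => //; rewrite map_mxD mulmxDr. Qed.

Lemma lattice_ofN (R : realType) n k (B : 'M[R]_(n, k)) x :
  lattice_of B x -> lattice_of B (- x).
Proof. by move=> [z _ <-]; exists (- z) => //; rewrite map_mxN mulmxN. Qed.

Lemma lattice_ofMn (R : realType) n k (B : 'M[R]_(n, k)) x m :
  lattice_of B x -> lattice_of B (x *+ m).
Proof.
move=> Bx; elim: m => [|m IHm]; first exact: lattice_of0.
by rewrite mulrS; apply: lattice_ofD.
Qed.

Lemma lattice_of_col (R : realType) n k (B : 'M[R]_(n, k)) j :
  lattice_of B (col j B).
Proof.
exists (delta_mx j 0) => //; rewrite colE; congr (_ *m _).
by apply/matrixP => i l; rewrite !mxE; case: (_ && _).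
Qed.

Lemma image_mulmx_lattice (R : realType) m n k
    (U : 'M[R]_(m, n)) (B : 'M[R]_(n, k)) :
  [set U *m x | x in lattice_of B] = lattice_of (U *m B).
Proof.
apply/seteqP; split=> [_ [_ [z _ <-] <-]|_ [z _ <-]].
  by exists z => //; rewrite mulmxA.
by exists (B *m map_mx intr z); [exists z|rewrite mulmxA].
Qed.

(** Pigeonhole: the multiples of [x] meet finitely many cosets, so two distinct multiples share one,
    and their difference lies in the sublattice. *)
Lemma finite_index_torsion (R : realType) n k l (A : 'M[R]_(n, l)) (B : 'M[R]_(n, k)) x :
  finite_index (lattice_of B) (lattice_of A) -> lattice_of A x ->
  exists2 m, (0 < m)%N & lattice_of B (x *+ m).
Proof.
move=> finAB Ax; pose f m := [set x *+ m + y | y in lattice_of B].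
have [m1 [m2 [lt_m f_eq]]] : exists m1 m2, (m1 < m2)%N /\ f m1 = f m2.
  apply: contrapT => f_inj; apply: infinite_nat.
  apply: sub_finite_set (finite_preimage (f := f) _ finAB) => [m _|].
    by exists (x *+ m) => //; apply: lattice_ofMn.
  move=> m1 m2 _ _ f_eq; apply: contrapT => /eqP; rewrite neq_ltn.
  by case/orP => lt_m; apply: f_inj; [exists m1, m2|exists m2, m1].
exists (m2 - m1)%N; first by rewrite subn_gt0.
have : f m2 (x *+ m2) by exists 0; rewrite ?addr0 //; apply: lattice_of0.
by rewrite -f_eq mulrnBr ?(ltnW lt_m) // => -[y By <-]; rewrite addrC addKr.
Qed.

(** As [Z *m \adj Z] is the scalar [\det Z], the coset of [A z] depends only on the residues of the
    entries of [z] modulo [\det Z]. *)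
Lemma finite_index_lattice_mulmx (R : realType) n (A : 'M[R]_n) (Z : 'M[int]_n) :
  \det Z != 0 -> finite_index (lattice_of (A *m map_mx intr Z)) (lattice_of A).
Proof.
set d := \det Z => d0; set M := lattice_of _.
(* Residues are below [absz d]; the successor makes the ordinal type syntactically nonempty, as
   [inord] requires. *)
pose f (r : 'cV['I_(absz d).+1]_n) :=
  [set A *m map_mx (fun i => (nat_of_ord i)%:R) r + y | y in M].
have fin : finite_set [set f r | r in setT] by apply: finite_image; apply: finite_finset.
apply: sub_finite_set fin.
move=> _ [_ [z _ <-] <-].
pose r : 'cV['I_(absz d).+1]_n := \col_i inord (absz (modz (z i 0) d)).
pose q : 'cV[int]_n := \col_i divz (z i 0) d.
have zE : map_mx intr z = map_mx intr (d *: q) + map_mx (fun i => (nat_of_ord i)%:R) r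
    :> 'cV[R]_n.
  apply/colP => i; rewrite !mxE inordK; last first.
    by rewrite ltnS ltnW // -ltz_nat !abszE ger0_norm ?modz_ge0 // ltz_mod.
  rewrite {1}(divz_eq (z i 0) d) rmorphD /= mulrC; congr (_ + _).
  by rewrite -[in LHS](gez0_abs (modz_ge0 (z i 0) d0)).
have My : M (A *m map_mx intr (d *: q)).
  exists (\adj Z *m q) => //.
  by rewrite -mulmxA -map_mxM mulmxA mul_mx_adj mul_scalar_mx.
exists r => //; rewrite zE mulmxDr /f.
set y := A *m map_mx intr (d *: q) in My *.
apply/seteqP; split=> _ [m Mm <-].
  exists (m - y); first by apply: lattice_ofD => //; apply: lattice_ofN.
  by rewrite [y + _]addrC -!addrA [y + _]addrC subrK.
by exists (y + m); [apply: lattice_ofD|rewrite addrA [y + _]addrC].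
Qed.

(** A positive multiple of each column of [A] is an integral combination of the columns of [B];
    dividing by the multipliers factors [A] through [B]. *)
Lemma finite_index_rank (R : realType) n k l (A : 'M[R]_(n, l)) (B : 'M[R]_(n, k)) :
  finite_index (lattice_of B) (lattice_of A) -> (\rank A <= \rank B)%N.
Proof.
move=> finAB.
have /choice[f fP] j : exists mz : nat * 'cV[int]_k,
    (0 < mz.1)%N /\ B *m map_mx intr mz.2 = col j A *+ mz.1.
  have [m m0 [z _ Bz]] := finite_index_torsion finAB (lattice_of_col A j).
  by exists (m, z).
pose m : 'rV[R]_l := \row_j (f j).1%:R.
have m_unit : diag_mx m \in unitmx.
  by apply: unitmx_diag => j; rewrite mxE pnatr_eq0 -lt0n; have [] := fP j.
have -> : A = B *m (\matrix_(i, j) ((f j).2 i 0)%:~R *m invmx (diag_mx m)).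
  rewrite mulmxA; apply: (canRL (mulmxK m_unit)).
  apply/matrixP => i j; have [_ /matrixP/(_ i 0)] := fP j.
  rewrite mul_mx_diag !mxE mulmxnE !mxE mulr_natr => <-.
  by apply: eq_bigr => h _; rewrite !mxE.
exact: mxrankM_maxl.
Qed.

(** * Orthogonal bases and virtual rectangularity *)

Lemma orthogonal_columns_QD (R : rcfType) n (B : 'M[R]_n) :
  B \in unitmx -> is_diag_mx (B^T *m B) ->
  exists (V : 'M[R]_n) (s : 'rV[R]_n),
    [/\ V^T *m V = 1%:M, forall i, s 0 i != 0 & B = V *m diag_mx s].
Proof.
move=> Bu /diag_mxP[g BB].
have g_gt0 i : 0 < g 0 i.
  have BTu : B^T \in unitmx by rewrite unitmx_tr.
  have /rV0Pn[j] := unitmx_row_neq0 i BTu; rewrite !mxE => Bji0.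
  have /matrixP/(_ i i) := BB; rewrite !mxE eqxx mulr1n => <-.
  rewrite (bigD1 j) //= ltr_pwDl ?mxE -?expr2 ?exprn_even_gt0 //.
  by apply: sumr_ge0 => l _; rewrite mxE -expr2 sqr_ge0.
have s_neq0 i : Num.sqrt (g 0 i) != 0 by rewrite gt_eqF ?sqrtr_gt0.
(* The entries of [g] are the squared lengths of the columns of [B], so scaling by [t] normalizes
   these columns. *)
pose s := \row_i Num.sqrt (g 0 i); pose t := \row_i (Num.sqrt (g 0 i))^-1.
exists (B *m diag_mx t), s; split=> [|i|]; first last.
- rewrite -mulmxA mulmx_diag -[LHS]mulmx1; congr (_ *m _).
  by apply/matrixP => i j; rewrite !mxE mulVf.
- by rewrite mxE.
rewrite trmx_mul tr_diag_mx mulmxA -[_ *m B]mulmxA BB !mulmx_diag.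
apply/matrixP => i j; rewrite !mxE; congr (_ *+ _).
by rewrite -[X in _ * X / _]sqr_sqrtr ?ltW // expr2 mulKf // divff.
Qed.

Lemma virtually_rectangular_axial (R : realType) n (L' : set 'cV[R]_n) :
  full_rank_lattice L' -> virtually_rectangular L' ->
  exists L, [/\ full_rank_lattice L, isometric L L' & axial L].
Proof.
move=> [A [Au ->]] [M [BA [k [B [rankB Bdiag def_M]]] finAB]].
subst M.
(* A rectangular sublattice may have any rank [k]; finite index forces [k = n], so that [B] is
   square and invertible. *)
have le_nB : (n <= \rank B)%N.
  by rewrite -[leqLHS](mxrank_unit Au); apply: finite_index_rank.
have def_k : k = n.
  by apply/eqP; rewrite eqn_leq -[in X in _ && X]rankB le_nB -rankB rank_leq_row.
subst k.
have Bu : B \in unitmx by rewrite -row_full_unit /row_full rankB.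
have [V [s [VV s0 def_B]]] := orthogonal_columns_QD Bu Bdiag.
have VV' := mulmx1C VV.
exists (lattice_of (V^T *m A)); split.
- exists (V^T *m A); split=> //; rewrite unitmx_mul Au andbT.
  by have [] := mulmx1_unit VV.
- by exists V; split=> //; rewrite image_mulmx_lattice mulmxA VV' mul1mx.
move=> i; exists (s 0 i) => //.
(* Column [i] of [B] lies in [L'], and [V^T] carries it to [s 0 i] times the unit vector of axis
   [i]. *)
have [z _ Az] := BA _ (lattice_of_col B i).
exists z => //; rewrite -mulmxA Az def_B colE !mulmxA VV mul1mx -colE.
by apply/colP => j; rewrite !mxE eqxx andbT mulr_natr; case: eqVneq => // ->.
Qed.

Lemma axial_virtually_rectangular (R : realType) n (L L' : set 'cV[R]_n) :
  full_rank_lattice L -> isometric L L' -> axial L -> virtually_rectangular L'.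
Proof.
move=> [A [Au ->]] [U [UU ->]] /axial_diag[c [Z [c0 AZ]]].
rewrite image_mulmx_lattice; exists (lattice_of (U *m A *m map_mx intr Z)); split.
- move=> _ [z _ <-]; exists (Z *m z) => //.
  by rewrite map_mxM !mulmxA.
- exists n, (U *m A *m map_mx intr Z); split=> //.
    rewrite -mulmxA AZ mxrank_unit // unitmx_mul unitmx_diag // andbT.
    by have [] := mulmx1_unit UU.
  (* The orthogonal factor cancels in the Gram matrix, leaving the square of [diag_mx c]. *)
  rewrite -mulmxA AZ trmx_mul tr_diag_mx mulmxA -[_ *m U]mulmxA UU mulmx1 mulmx_diag.
  exact: diag_mx_is_diag.
apply: finite_index_lattice_mulmx; apply/eqP => Z0.
have := unitmx_diag c0; rewrite -AZ unitmxE unitfE det_mulmx det_map_mx Z0.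
by rewrite rmorph0 mulr0 eqxx.
Qed.

Theorem theorem1p2 (R : realType) (n : nat) :
  (forall L : set 'cV[R]_n, full_rank_lattice L ->
     (lat_d L = n <-> 0 < lat_nu L) /\
     (0 < lat_nu L <->
        forall i : nat, (1 <= i <= n)%N -> succ_sparsity L i = 1%N)) /\
  (forall L' : set 'cV[R]_n, full_rank_lattice L' ->
     (virtually_rectangular L' <->
        exists L : set 'cV[R]_n,
          [/\ full_rank_lattice L,
              isometric L L' &
              [/\ lat_d L = n,
                  0 < lat_nu L &
                  forall i : nat, (1 <= i <= n)%N -> succ_sparsity L i = 1%N]])).
Proof.
split=> [L latL|L' latL'].
  by rewrite lat_d_axial // lat_nu_axial // succ_sparsity_axial.
split=> [/(virtually_rectangular_axial latL')[L [latL LL' axL]]|].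
  exists L; split=> //; split; first exact/lat_d_axial.
    exact/lat_nu_axial.
  exact/succ_sparsity_axial.
move=> [L [latL LL' [_ /(lat_nu_axial latL) axL _]]].
exact: axial_virtually_rectangular latL LL' axL.
Qed.
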